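(* Let $(s_n)_{n\ge 0}$ be a nonincreasing sequence of positive real numbers such that $S_n:=\sum_{k=0}^{n-1}s_k\to\infty$ as $n\to\infty$, and let $(a_n)_{n\ge 0}$ be any bounded sequence of real numbers. Then the following hold. (i) If $\limsup_{n\to\infty}\frac{S_n}{n s_n}<\infty$, then the sequence $\frac1n\sum_{k=0}^{n-1}a_k$ is convergent if and only if the sequence $\frac1{S_n}\sum_{k=0}^{n-1}s_ka_k$ is convergent, and in this case the limits are equal. (ii) If $\limsup_{n\to\infty}\frac{S_n}{n s_n}=\infty$, then convergence of the sequence $\frac1n\sum_{k=0}^{n-1}a_k$ implies convergence of the sequence $\frac1{S_n}\sum_{k=0}^{n-1}s_ka_k$ to the same limit, but the converse fails: for every such $(s_n)_{n\ge0}$ (positive, nonincreasing, $S_n\to\infty$, $\limsup_{n\to\infty}\frac{S_n}{ns_n}=\infty$) there exists a bounded sequence of real numbers $(a_n)_{n\ge0}$ such that $\frac1{S_n}\sum_{k=0}^{n-1}s_ka_k$ converges while $\frac1n\sum_{k=0}^{n-1}a_k$ diverges.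
   Context: A sequence $(s_n)_{n\ge0}$ of positive reals is called nonsummable if $S_n=\sum_{k=0}^{n-1}s_k\to\infty$ as $n\to\infty$. *)

(* Defs.v *)
From HB Require Import structures.
From mathcomp Require Import all_boot all_order all_algebra.
From mathcomp Require Import all_classical all_reals all_analysis.

Set Implicit Arguments.
Unset Strict Implicit.
Unset Printing Implicit Defensive.

Import Order.TTheory GRing.Theory Num.Theory.
Import numFieldNormedType.Exports.

Local Open Scope classical_set_scope.
Local Open Scope ring_scope.

(* [series s n] is the sum over 0 <= k < n.  The terms at n = 0 below are
   divisions by zero (with value 0); they affect neither limits nor limsups. *)

Definition mean (R : realType) (a : R^nat) : R^nat :=
  fun n => series a n / n%:R.

Definition weighted_mean (R : realType) (s a : R^nat) : R^nat :=
  fun n => series (fun k => s k * a k) n / series s n.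

Definition sum_ratio (R : realType) (s : R^nat) : R^nat :=
  fun n => series s n / (n%:R * s n).

(* Main.v *)
Require Import Defs.
From HB Require Import structures.
From mathcomp Require Import all_boot all_order all_algebra.
From mathcomp Require Import all_classical all_reals all_analysis.
From mathcomp Require Import ring lra zify.

(** Both averages are weighted means of the sequence [a]: the plain mean has
    constant weights, and multiplying these by [s], or the weights [s] by
    [1 / s], passes from one mean to the other.  So everything that converges
    follows from one statement about changing weights [p] into [w * p] with [w]
    monotone ([cvg_change_weights]).  Write [P] and [Q] for the partial sums of
    [p] and [w * p].  If the [p]-mean of [a] tends to [L], the partial sums [X]
    of [p * (a - L)] are small compared with [P], and summation by parts gives

      sum_(k < n) w_k p_k (a_k - L)
        = w_n X_n - sum_(k < n) (w_(k+1) - w_k) X_(k+1).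

    Since [w] is monotone, its increments all have the same sign, and the same
    formula with [p] in place of [p * (a - L)] shows that their absolute values
    sum against [P] to at most [w_n P_n + Q_n].  Hence the right-hand
    side is small compared with [Q_n] as soon as [w_n P_n = O(Q_n)].
    - From the plain to the [s]-weighted mean this condition is
      [n s_n <= S_n], which holds because [s] is nonincreasing.
    - From the [s]-weighted to the plain mean it is [S_n / s_n = O(n)], that is,
      boundedness of the ratio [S_n / (n s_n)].

    If that ratio is unbounded, there are arbitrarily large [N] for which the
    whole block [N <= k < 2N], of weight at most [N s_N], is negligible compared
    with [S_N].  Let [a] be the indicator of the union of such blocks, chosen so
    sparsely that everything before a block is also negligible compared with
    [S_N].  The weighted mean of [a] then tends to [0] ([series_block_tail]),
    while its plain mean is at least [1/2] at the end of each block
    ([mean_block_ge]).  The plain mean cannot converge, because by the first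
    part its limit would have to be [0]. *)

Set Implicit Arguments.
Unset Strict Implicit.
Unset Printing Implicit Defensive.

Import Order.TTheory GRing.Theory Num.Theory.
Import numFieldNormedType.Exports.

Local Open Scope classical_set_scope.
Local Open Scope ring_scope.

(** * Weighted means and partial sums *)

Lemma series_gt0 (R : realType) (p : R^nat) (n : nat) :
  (forall k, 0 < p k) -> (0 < n)%N -> 0 < series p n.
Proof.
move=> p0; case: n => // n _; elim: n => [|n IHn].
  by rewrite seriesSr /series/= big_geq// add0r.
by rewrite seriesSr addr_gt0.
Qed.

Lemma series_le (R : realType) (p : R^nat) (m n : nat) :
  (forall k, 0 < p k) -> (m <= n)%N -> series p m <= series p n.
Proof. by move=> p0; apply: nondecreasing_series => k _ _; exact: ltW. Qed.

(** Convergence of a weighted mean in a form free of division, where changes of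
    weights can be estimated directly. *)
Lemma cvg_weighted_meanP (R : realType) (p x : R^nat) (L : R) :
  (forall k, 0 < p k) ->
  weighted_mean p x @ \oo --> L <->
  (forall e, 0 < e -> \forall n \near \oo,
     `|series (fun k => p k * (x k - L)) n| <= e * series p n).
Proof.
move=> p0.
have E n : (0 < n)%N -> series (fun k => p k * (x k - L)) n =
    - (L - weighted_mean p x n) * series p n.
  move=> n0; rewrite /weighted_mean mulNr mulrBl divfK ?gt_eqF ?series_gt0//.
  rewrite opprB /series/= mulr_sumr -sumrB; apply: eq_bigr => k _.
  by rewrite mulrBr (mulrC L).
split=> [/cvgrPdist_le H e e0|H]; last apply/cvgrPdist_le => e e0; near=> n.
- have n0 : (0 < n)%N by near: n; exact: nbhs_infty_gt.
  rewrite E// normrM normrN (gtr0_norm (series_gt0 p0 n0)).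
  rewrite ler_pM2r ?series_gt0//; near: n.
  exact: (H e e0).
- have n0 : (0 < n)%N by near: n; exact: nbhs_infty_gt.
  have : `|series (fun k => p k * (x k - L)) n| <= e * series p n.
    by near: n; exact: H.
  rewrite E// normrM normrN (gtr0_norm (series_gt0 p0 n0)).
  by rewrite ler_pM2r ?series_gt0.
Unshelve. all: by end_near. Qed.

(** * Changing the weights by a monotone factor *)

Lemma series_by_parts (R : realType) (w x : R^nat) (n : nat) :
  series (fun k => w k * x k) n =
  w n * series x n - series (fun k => (w k.+1 - w k) * series x k.+1) n.
Proof.
elim: n => [|n IHn]; first by rewrite /series/= !big_geq// mulr0 subr0.
rewrite !(seriesSr _ n) IHn; ring.
Qed.

(** The increments of a monotone [w] have constant sign, so [series_by_parts]
    evaluates this sum: it is, up to sign, the difference of the two terms on the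
    right. *)
Lemma variation_le (R : realType) (p w : R^nat) (n : nat) :
  (forall k, 0 < p k) -> (forall k, 0 < w k) ->
  nonincreasing_seq w \/ nondecreasing_seq w ->
  series (fun k => `|w k.+1 - w k| * series p k.+1) n <=
  w n * series p n + series (fun k => w k * p k) n.
Proof.
move=> p0 w0 mon.
have wP : 0 <= w n * series p n.
  by rewrite mulr_ge0 ?(ltW (w0 _))//; apply: sumr_ge0 => k _; exact: ltW.
have Q : 0 <= series (fun k => w k * p k) n.
  by apply: sumr_ge0 => k _; rewrite mulr_ge0 ?ltW.
have [b E] : exists b : bool, forall k, `|w k.+1 - w k| = (-1) ^+ b * (w k.+1 - w k).
  case: mon => mon; [exists true|exists false] => k.
    by rewrite ler0_norm ?subr_le0 ?mon// expr1 mulN1r.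
  by rewrite ger0_norm ?subr_ge0 ?mon// expr0 mul1r.
have -> : series (fun k => `|w k.+1 - w k| * series p k.+1) n =
    (-1) ^+ b * series (fun k => (w k.+1 - w k) * series p k.+1) n.
  by rewrite [in RHS]/series/= mulr_sumr; apply: eq_bigr => k _; rewrite E mulrA.
move: (series_by_parts w p n) wP Q.
by case: b {E}; rewrite ?expr0 ?expr1; lra.
Qed.

(** In the summation by parts, the terms before [N] contribute the constant [M];
    in all others [series x] is at most [e] times [series p], which leaves the
    boundary term and the variation bounded by [variation_le]. *)
Lemma by_parts_bound (R : realType) (p w x : R^nat) (N : nat) (e : R) :
  (forall k, 0 < p k) -> (forall k, 0 < w k) -> 0 < e ->
  nonincreasing_seq w \/ nondecreasing_seq w ->
  (forall n, (N <= n)%N -> `|series x n| <= e * series p n) ->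
  exists M, forall n, (N <= n)%N ->
  `|series (fun k => w k * x k) n| <=
  M + e * (2 * (w n * series p n) + series (fun k => w k * p k) n).
Proof.
move=> p0 w0 e0 mon xN.
pose T n := series (fun k => (w k.+1 - w k) * series x k.+1) n.
pose V n := series (fun k => `|w k.+1 - w k| * series p k.+1) n.
have Vge0 n : 0 <= V n.
  apply: sumr_ge0 => k _; rewrite mulr_ge0//; apply: sumr_ge0 => i _; exact: ltW.
exists `|T N| => n Nn.
have TV : `|T n| <= `|T N| + e * V n.
  move: Nn; elim: n => [|n IHn].
    by rewrite leqn0 => /eqP ->; rewrite lerDl mulr_ge0// ltW.
  rewrite leq_eqVlt => /predU1P[<-|Nn]; first by rewrite lerDl mulr_ge0// ltW.
  have -> : T n.+1 = T n + (w n.+1 - w n) * series x n.+1 by exact: seriesSr.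
  have -> : V n.+1 = V n + `|w n.+1 - w n| * series p n.+1 by exact: seriesSr.
  rewrite mulrDr addrA (le_trans (ler_normD _ _))// lerD//; first exact: IHn.
  by rewrite normrM mulrCA ler_wpM2l// xN// leqW.
rewrite series_by_parts (le_trans (ler_normB _ _))// normrM gtr0_norm//.
have h1 : w n * `|series x n| <= e * (w n * series p n).
  by rewrite mulrCA ler_wpM2l ?xN// ltW.
have h2 : e * V n <= e * (w n * series p n + series (fun k => w k * p k) n).
  by rewrite ler_wpM2l ?variation_le// ltW.
move: h1 h2 TV; rewrite -/(T n) !mulrDr; lra.
Qed.

(** With [P] and [Q] the partial sums of [p] and [w * p], the error is at most
    [M + d * (2 * w n * P n + Q n) <= M + d * (2 * C + 1) * Q n] for any fixed
    [d > 0]; the constant [M] is absorbed because [Q] tends to infinity. *)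
Lemma cvg_change_weights (R : realType) (p w x : R^nat) (L C : R) :
  (forall k, 0 < p k) -> (forall k, 0 < w k) ->
  nonincreasing_seq w \/ nondecreasing_seq w ->
  series (fun k => w k * p k) @ \oo --> +oo -> 0 <= C ->
  (\forall n \near \oo, w n * series p n <= C * series (fun k => w k * p k) n) ->
  weighted_mean p x @ \oo --> L ->
  weighted_mean (fun k => w k * p k) x @ \oo --> L.
Proof.
move=> p0 w0 mon Qoo C0 wPC /cvg_weighted_meanP-/(_ p0) H.
apply/cvg_weighted_meanP => [k|e e0]; first exact: mulr_gt0.
(* Half of [e] pays for the oscillating part, the other half for [M]. *)
pose d := e / 2 / (2 * C + 1).
have C1 : 0 < 2 * C + 1 by lra.
have d0 : 0 < d by rewrite /d !divr_gt0.
have [N _ HN] := H d d0.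
have [M HM] := by_parts_bound p0 w0 d0 mon HN.
move/cvgryPge/(_ (2 / e * M)) : Qoo => MQoo.
near=> n.
have -> : series (fun k => w k * p k * (x k - L)) n =
          series (fun k => w k * (p k * (x k - L))) n.
  by apply: eq_bigr => k _; rewrite mulrA.
apply: le_trans (HM n _) _; first by near: n; exact: nbhs_infty_ge.
have MQ : 2 / e * M <= series (fun k => w k * p k) n by near: n.
have wQ : w n * series p n <= C * series (fun k => w k * p k) n by near: n.
set Q := series (fun k => w k * p k) n in MQ wQ *.
have {}MQ : M <= e / 2 * Q.
  by move: MQ; rewrite mulrAC ler_pdivrMr// => MQ; lra.
have dC : d * (2 * C + 1) = e / 2 by rewrite /d divfK ?gt_eqF.
have : d * (2 * (w n * series p n) + Q) <= e / 2 * Q.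
  by rewrite -dC -mulrA ler_wpM2l ?(ltW d0)//; lra.
lra.
Unshelve. all: by end_near. Qed.

(** * Plain and weighted means *)

Lemma series1 (R : realType) n : series (fun=> 1 : R) n = n%:R.
Proof. by rewrite /series/= big_mkord sumr_const card_ord. Qed.

Lemma meanE (R : realType) (a : R^nat) : mean a = weighted_mean (fun=> 1) a.
Proof.
apply/funext => n; rewrite /mean /weighted_mean; congr (_ / _).
  by apply: eq_bigr => k _; rewrite mul1r.
by rewrite series1.
Qed.

(** Weights [1] changed by the factor [s]; the growth condition reads
    [n * s n <= series s n], and each of the [n] summands is at least [s n]. *)
Lemma cvg_mean_weighted (R : realType) (s a : R^nat) (L : R) :
  (forall n, 0 < s n) -> nonincreasing_seq s ->
  series s @ \oo --> +oo ->
  mean a @ \oo --> L -> weighted_mean s a @ \oo --> L.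
Proof.
move=> s0 dec soo; rewrite meanE => aL.
have E : s = (fun k => s k * 1) by apply/funext => k; rewrite mulr1.
rewrite E; apply: (@cvg_change_weights _ (fun=> 1) s a L 1) => //.
- by left.
- by rewrite -E.
near=> n; rewrite -E series1 mul1r mulr_natr /series/= big_mkord.
rewrite -[X in _ *+ X]card_ord -sumr_const; apply: ler_sum => k _.
by apply: dec; rewrite ltnW.
Unshelve. all: by end_near. Qed.

(** Weights [s] changed by the nondecreasing factor [1 / s]; the growth condition
    is precisely the bound on [sum_ratio s]. *)
Lemma cvg_weighted_mean_mean (R : realType) (s a : R^nat) (L C : R) :
  (forall n, 0 < s n) -> nonincreasing_seq s -> 0 <= C ->
  (\forall n \near \oo, sum_ratio s n <= C) ->
  weighted_mean s a @ \oo --> L -> mean a @ \oo --> L.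
Proof.
move=> s0 dec C0 sC aL; rewrite meanE.
have E : (fun=> 1 : R) = (fun k => (s k)^-1 * s k).
  by apply/funext => k; rewrite mulVf ?gt_eqF.
rewrite E; apply: (@cvg_change_weights _ s (fun k => (s k)^-1) a L C) => //.
- by move=> k; rewrite invr_gt0.
- by right=> m n mn; rewrite lef_pV2 ?posrE//; exact: dec.
- rewrite -E (_ : series _ = fun n => n%:R); first exact: cvgr_idn.
  by apply/funext => n; rewrite series1.
near=> n; rewrite -E series1.
have n0 : (0 < n)%N by near: n; exact: nbhs_infty_gt.
have : sum_ratio s n <= C by near: n.
rewrite /sum_ratio ler_pdivrMr ?mulr_gt0 ?ltr0n// => h.
by rewrite mulrC ler_pdivrMr// -mulrA.
Unshelve. all: by end_near. Qed.

(** * Finite and infinite upper limits *)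

Lemma limn_esup_lty_bounded (R : realType) (u : R^nat) :
  (limn_esup (fun n => (u n)%:E) < +oo)%E ->
  exists2 C, 0 <= C & \forall n \near \oo, u n <= C.
Proof.
move=> /ereal_inf_lt[y [A Aoo <-]].
case E : (ereal_sup _) => [r| |] //= _.
  exists (Num.max 0 r); first by rewrite le_max lexx.
  apply: filterS Aoo => n An; rewrite le_max; apply/orP; right.
  by rewrite -lee_fin -E; apply: ereal_sup_ubound; exists n.
exists 0 => //; apply: filterS Aoo => n An.
have : ((u n)%:E <= -oo)%E by rewrite -E; apply: ereal_sup_ubound; exists n.
by rewrite leeNy_eq.
Qed.

Lemma limn_esup_eqy_frequently (R : realType) (u : R^nat) (N : nat) (C : R) :
  limn_esup (fun n => (u n)%:E) = +oo%E ->
  exists2 n, (N <= n)%N & C < u n.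
Proof.
move=> uoo.
have [n /= [Nn Cn]] : exists n, (N <= n)%N /\ C < u n; last by exists n.
apply: contrapT => nex.
have : (limn_esup (fun n => (u n)%:E) <= C%:E)%E.
  apply: le_trans.
    apply: ereal_inf_lbound; exists [set n | (N <= n)%N] => //.
    exact: nbhs_infty_ge.
  apply: ge_ereal_sup => _ [n Nn <-]; rewrite lee_fin leNgt.
  by apply/negP => Cn; apply: nex; exists n.
by rewrite uoo.
Qed.

(** * Sparse blocks *)

(** The left ends of the blocks.  At the scale [N j.+1], both the mass
    [series s (N j).*2] of everything up to the end of the previous block and the
    mass of the new block are at most a fraction [1 / j.+1] of
    [series s (N j.+1)]. *)
Lemma exists_sparse_scales (R : realType) (s : R^nat) :
  (forall n, 0 < s n) -> series s @ \oo --> +oo ->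
  limn_esup (fun n => (sum_ratio s n)%:E) = +oo%E ->
  exists N : nat -> nat, [/\ (0 < N 0)%N,
    forall j, ((N j).*2 <= N j.+1)%N,
    forall j, j.+1%:R * series s (N j).*2 <= series s (N j.+1) &
    forall j, j.+1%:R * ((N j.+1)%:R * s (N j.+1)) <= series s (N j.+1)].
Proof.
move=> s0 soo ratio_oo.
have next (jm : nat * nat) : exists n, [/\ (jm.2 <= n)%N,
    jm.1.+1%:R * series s jm.2 <= series s n &
    jm.1.+1%:R * (n%:R * s n) <= series s n].
  case: jm => j m /=.
  have [K _ HK] := (cvgryPge _).1 soo (j.+1%:R * series s m).
  (* Beyond [K] the total weight dwarfs what precedes [m]; the [1] excludes
     the index at which the ratio is a division by zero. *)
  have [n] := limn_esup_eqy_frequently (maxn (maxn m K) 1) j.+1%:R ratio_oo.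
  rewrite !geq_max => /andP[/andP[mn Kn] n0] jn.
  exists n; split => //; first exact: HK.
  by move: jn; rewrite /sum_ratio ltr_pdivlMr ?mulr_gt0 ?ltr0n// => /ltW.
have [f Hf] := choice next.
exists (fun j => iteri j (fun j m => f (j, m.*2)) 1%N).
by split => // j /=; have [] := Hf (j, (iteri j (fun j m => f (j, m.*2)) 1%N).*2).
Qed.

Definition block_indicator (R : realType) (N : nat -> nat) : R^nat :=
  fun k => (`[< exists j, (N j <= k < (N j).*2)%N >])%:R.

Lemma block_indicator_itv (R : realType) (N : nat -> nat) (k : nat) :
  0 <= block_indicator R N k <= 1.
Proof. by rewrite /block_indicator; case: asbool; rewrite ?lexx ?ler01. Qed.

Lemma block_indicator1 (R : realType) (N : nat -> nat) (j k : nat) :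
  (N j <= k < (N j).*2)%N -> block_indicator R N k = 1.
Proof. by move=> jk; rewrite /block_indicator asboolT//; exists j. Qed.

Lemma doubling_homo (N : nat -> nat) :
  (forall j, ((N j).*2 <= N j.+1)%N) -> {homo N : i j / (i <= j)%N}.
Proof.
move=> N2; apply: homo_leq => // [i j k|j]; first exact: leq_trans.
by apply: leq_trans (N2 j); rewrite -addnn leq_addr.
Qed.

Lemma doubling_gt (N : nat -> nat) (j : nat) :
  (0 < N 0)%N -> (forall j, ((N j).*2 <= N j.+1)%N) -> (j < N j)%N.
Proof. by move=> N0 N2; elim: j => // j IHj; have := N2 j; lia. Qed.

Lemma block_indicator0 (R : realType) (N : nat -> nat) (j k : nat) :
  (forall j, ((N j).*2 <= N j.+1)%N) ->
  ((N j).*2 <= k < N j.+1)%N -> block_indicator R N k = 0.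
Proof.
move=> N2 /andP[jk kj]; rewrite /block_indicator asboolF// => -[i /andP[ik ki]].
have [ij|ji] := leqP i j; have := doubling_homo N2; last first.
  by move=> /(_ _ _ ji); lia.
by move=> /(_ _ _ ij); lia.
Qed.

Lemma series_gap (R : realType) (s : R^nat) (N : nat -> nat) (j n : nat) :
  (forall j, ((N j).*2 <= N j.+1)%N) -> ((N j).*2 <= n <= N j.+1)%N ->
  series (fun k => s k * block_indicator R N k) n =
  series (fun k => s k * block_indicator R N k) (N j).*2.
Proof.
move=> N2; elim: n => [|n IHn].
  by rewrite leqn0 andbT => /eqP ->.
move=> /andP[]; rewrite leq_eqVlt => /predU1P[->//|jn nj].
have jn' : ((N j).*2 <= n)%N by lia.
by rewrite seriesSr (@block_indicator0 _ _ j)// ?mulr0 ?addr0 ?IHn ?jn' ?(ltnW nj).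
Qed.

(** The blocks contribute nothing between [(N j).*2] and [N j.+1], and in the
    block starting at [N j] there are at most [N j] terms, none exceeding
    [s (N j)]. *)
Lemma series_block_le (R : realType) (s : R^nat) (N : nat -> nat) (j n : nat) :
  (forall n, 0 < s n) -> nonincreasing_seq s ->
  (forall j, ((N j).*2 <= N j.+1)%N) -> (N j <= n <= N j.+1)%N ->
  series (fun k => s k * block_indicator R N k) n <=
  series (fun k => s k * block_indicator R N k) (N j) + (N j)%:R * s (N j).
Proof.
move=> s0 dec N2 /andP[jn nj].
have in_block m : (m <= N j)%N ->
    series (fun k => s k * block_indicator R N k) (N j + m)%N <=
    series (fun k => s k * block_indicator R N k) (N j) + m%:R * s (N j).
  elim: m => [|m IHm mj]; first by rewrite addn0 mul0r addr0.
  rewrite addnS seriesSr -natr1 mulrDl addrA mul1r lerD ?IHm ?(ltnW mj)//.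
  have /andP[b0 b1] := block_indicator_itv R N (N j + m)%N.
  by rewrite (le_trans (ler_piMr _ b1)) ?(ltW (s0 _))// dec// leq_addr.
have [n2|n2] := leqP n (N j).*2; last first.
  by rewrite (@series_gap _ _ _ j)// ?(ltnW n2)// -addnn in_block.
rewrite -[in X in X <= _](subnKC jn) (le_trans (in_block _ _))//; first lia.
by rewrite lerD2l ler_wpM2r ?(ltW (s0 _))// ler_nat; lia.
Qed.

(** For [n] between [N j.+1] and [N j.+2], the weight of the blocks below [n] has
    two parts: that of the blocks before [N j.+1], which is at most
    [series s (N j).*2], and that of the block starting at [N j.+1].  By the
    choice of the scales each is at most [series s (N j.+1) / j.+1]. *)
Lemma series_block_tail (R : realType) (s : R^nat) (N : nat -> nat) (J n : nat) :
  (forall n, 0 < s n) -> nonincreasing_seq s -> (0 < N 0)%N ->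
  (forall j, ((N j).*2 <= N j.+1)%N) ->
  (forall j, j.+1%:R * series s (N j).*2 <= series s (N j.+1)) ->
  (forall j, j.+1%:R * ((N j.+1)%:R * s (N j.+1)) <= series s (N j.+1)) ->
  (N J.+1 <= n)%N ->
  J.+1%:R * series (fun k => s k * block_indicator R N k) n <= 2 * series s n.
Proof.
move=> s0 dec N0 N2 prev block Jn.
set W := series (fun k => s k * block_indicator R N k).
have W0 m : 0 <= W m.
  apply: sumr_ge0 => k _; have /andP[b0 _] := block_indicator_itv R N k.
  by rewrite mulr_ge0// ltW.
have WS m : W m <= series s m.
  apply: ler_sum => k _; have /andP[b0 b1] := block_indicator_itv R N k.
  by rewrite ler_piMr// ltW.
have step j m : (N j.+1 <= m <= N j.+2)%N -> j.+1%:R * W m <= 2 * series s m.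
  move=> /andP[jm mj].
  have h1 : W m <= W (N j.+1) + (N j.+1)%:R * s (N j.+1).
    by apply: series_block_le => //; rewrite jm.
  have h2 : W (N j.+1) <= series s (N j).*2.
    by rewrite /W (@series_gap _ _ _ j) ?N2 ?leqnn//; exact: WS.
  have h3 : j.+1%:R * W m <= j.+1%:R * (series s (N j).*2 + (N j.+1)%:R * s (N j.+1)).
    by rewrite ler_wpM2l//; lra.
  have := prev j; have := block j; have := series_le s0 jm.
  by move: h3; rewrite mulrDr; lra.
(* Every [m] from [N J.+1] on lies between two consecutive scales with index at
   least [J.+1]; they are found by induction on the number of scales passed. *)
have to_step i m : (N J.+1 <= m <= N (J + i).+1)%N -> J.+1%:R * W m <= 2 * series s m.
  elim: i => [|i IHi] /andP[Jm mi].
    apply: step; rewrite Jm; move: mi; rewrite addn0 => mi.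
    exact: leq_trans mi (doubling_homo N2 (leqnSn _)).
  have [mi'|im] := leqP m (N (J + i).+1); first by rewrite IHi ?Jm.
  apply: le_trans (step (J + i)%N m _); last by rewrite (ltnW im) -addnS.
  by rewrite ler_wpM2r// ler_nat ltnS leq_addr.
apply: (to_step n); rewrite Jn /=.
by have := doubling_gt (J + n).+1 N0 N2; lia.
Qed.

(** The second half of the first [2 * N j] terms consists of ones. *)
Lemma mean_block_ge (R : realType) (N : nat -> nat) (j : nat) :
  (0 < N j)%N -> 2^-1 <= mean (block_indicator R N) (N j).*2.
Proof.
move=> N0.
have A m : (m <= N j)%N -> m%:R <= series (block_indicator R N) (N j + m)%N.
  elim: m => [_|m IHm mj].
    by apply: sumr_ge0 => k _; have /andP[] := block_indicator_itv R N k.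
  rewrite addnS seriesSr -natr1 lerD ?IHm ?(ltnW mj)//.
  by rewrite (@block_indicator1 _ _ j)// leq_addr -addnn ltn_add2l.
rewrite /mean ler_pdivlMr ?ltr0n ?double_gt0// -{2}addnn.
by apply: le_trans (A _ (leqnn _)); rewrite -mul2n natrM mulrA mulVf ?mul1r// pnatr_eq0.
Qed.

(** A limit of the plain mean would also be the limit [0] of the weighted mean,
    so the values at least [1/2] at the ends of the blocks preclude it. *)
Lemma exists_weighted_not_mean (R : realType) (s : R^nat) :
  (forall n, 0 < s n) -> nonincreasing_seq s -> series s @ \oo --> +oo ->
  limn_esup (fun n => (sum_ratio s n)%:E) = +oo%E ->
  exists a : R^nat,
    bounded_fun a /\ cvgn (weighted_mean s a) /\ ~ cvgn (mean a).
Proof.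
move=> s0 dec soo ratio_oo.
have [N [N0 N2 prev block]] := exists_sparse_scales s0 soo ratio_oo.
exists (block_indicator R N).
have w0 : weighted_mean s (block_indicator R N) @ \oo --> 0.
  apply/cvg_weighted_meanP => // e e0; near=> n.
  under [X in series X]eq_fun do rewrite subr0.
  rewrite ger0_norm; last first.
    apply: sumr_ge0 => k _; have /andP[b0 _] := block_indicator_itv R N k.
    by rewrite mulr_ge0// ltW.
  pose J := Num.truncn (2 / e).
  have eJ : 2 <= e * J.+1%:R.
    by rewrite mulrC -ler_pdivrMr// ltW// truncnS_gt.
  have Jn : (N J.+1 <= n)%N by near: n; exact: nbhs_infty_ge.
  have WJ := series_block_tail s0 dec N0 N2 prev block Jn.
  rewrite -(ler_pM2l (ltr0Sn R J)) (le_trans WJ)// mulrA (mulrC _ e).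
  by rewrite ler_wpM2r//; apply: sumr_ge0 => k _; exact: ltW.
split; [|split].
- exists 1; split => // M M1 k _ /=; have /andP[b0 b1] := block_indicator_itv R N k.
  by rewrite ger0_norm// (le_trans b1)// ltW.
- by apply/cvg_ex; exists 0.
- move=> /cvg_ex[L mL].
  have L0 : L = 0.
    by apply: cvg_unique w0; [exact: norm_hausdorff|exact: cvg_mean_weighted].
  move: mL; rewrite L0 => /cvgrPdist_lt/(_ 2^-1); rewrite invr_gt0 ltr0n.
  move=> /(_ isT)[K _ HK].
  have KN := doubling_gt K N0 N2.
  have /HK : (K <= (N K).*2)%N by lia.
  have := @mean_block_ge R N K (leq_ltn_trans (leq0n _) KN).
  by rewrite /= sub0r normrN => h; rewrite ltNge (le_trans h)// ler_norm.
Unshelve. all: by end_near. Qed.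

(** * Comparison of the two means *)

Theorem theorem1p1 (R : realType) (s : R^nat)
    (s_gt0 : forall n, 0 < s n)
    (s_noninc : nonincreasing_seq s)
    (s_nonsummable : series s n @[n --> \oo] --> +oo) :
  ((limn_esup (fun n => (sum_ratio s n)%:E) < +oo)%E ->
    forall a : R^nat, bounded_fun a ->
      (cvgn (mean a) <-> cvgn (weighted_mean s a)) /\
      (cvgn (mean a) -> limn (mean a) = limn (weighted_mean s a)))
  /\
  (limn_esup (fun n => (sum_ratio s n)%:E) = +oo%E ->
    (forall a : R^nat, bounded_fun a ->
      cvgn (mean a) ->
      cvgn (weighted_mean s a) /\ limn (weighted_mean s a) = limn (mean a)) /\
    (exists a : R^nat,
      bounded_fun a /\ cvgn (weighted_mean s a) /\ ~ cvgn (mean a))).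
Proof.
have regular (a : R^nat) : cvgn (mean a) ->
    weighted_mean s a @ \oo --> limn (mean a).
  by move=> ca; exact: cvg_mean_weighted.
split=> [/limn_esup_lty_bounded[C C0 sC] a _|ratio_oo]; split.
- split=> [/regular ca|ca]; first by apply/cvg_ex; exists (limn (mean a)).
  apply/cvg_ex; exists (limn (weighted_mean s a)).
  exact: cvg_weighted_mean_mean sC ca.
- by move=> /regular/cvg_lim ->.
- by move=> a _ /regular ca; split; [apply/cvg_ex; exists (limn (mean a))|exact: cvg_lim].
- exact: exists_weighted_not_mean.
Qed.
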